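(* Let $\Lambda$ be an infinite irreducible preordered set and let $P$ be a finite commutative ring with the discrete topology. If $\Lambda$ has finite neighborhoods, then the quasicentre $\mathrm{QZ}(\mathrm{GL}_\Lambda(P))$ is dense in $\mathrm{GL}_\Lambda(P)$.
   Context: Let $(\Lambda,\preceq)$ be a preordered set (proset). For $s\in\Lambda$ put $\mathcal{N}_0(s)=\{t: s\preceq t\preceq s\}$, $\mathcal{N}_1(s)=\{t\in\Lambda: t\preceq s\text{ or }s\preceq t\}$, $\mathcal{N}_n(s)=\bigcup_{t\in\mathcal{N}_{n-1}(s)}\mathcal{N}_1(t)$ for $n>1$, and $\mathcal{N}_\omega(s)=\bigcup_n\mathcal{N}_n(s)$. Elements $s_1,s_2$ are independent if $s_1\notin\mathcal{N}_\omega(s_2)$. $\Lambda$ is irreducible if it cannot be written as the union of two disjoint non-empty subsets such that every element of one is independent from every element of the other. $\Lambda$ has finite neighborhoods if $\mathcal{N}_1(s)$ is finite for every $s\in\Lambda$; in particular all intervals $[s_1,s_2]=\{t: s_1\preceq t\preceq s_2\}$ are then finite. Rings have an identity and are nontrivial. The incidence ring is $\mathrm{M}_\Lambda(P)=\{(a_{s_1,s_2})\in P^{\Lambda\times\Lambda}: a_{s_1,s_2}\neq 0\Rightarrow s_1\preceq s_2\}$ with coordinatewise addition and multiplication $(ab)_{s_1,s_2}=\sum_{t\in[s_1,s_2]}a_{s_1,t}b_{t,s_2}$. $\mathrm{GL}_\Lambda(P)$ is its group of units, a topological group with the subspace topology from the product topology on $P^{\Lambda\times\Lambda}$. The quasicentre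 of a topological group $G$ is $\mathrm{QZ}(G)=\{g\in G: C_G(g)\text{ is open in }G\}$, where $C_G(g)$ is the centralizer of $g$. *)

(* Defs.v *)
From HB Require Import structures.
From mathcomp Require Import all_boot all_order all_algebra finmap.
From mathcomp Require Import boolp classical_sets functions cardinality fsbigop.
From mathcomp Require Import filter topology.

Set Implicit Arguments.
Unset Strict Implicit.
Unset Printing Implicit Defensive.

Import Order.TTheory GRing.Theory.
Local Open Scope classical_set_scope.

Section Proset.
Local Open Scope order_scope.
Context {d : Order.disp_t} {L : preorderType d}.
Implicit Types (s t u : L) (n : nat).

Definition neighborhood1 s : set L := [set t | (t <= s) || (s <= t)].

Fixpoint neighborhood n s : set L :=
  match n with
  | 0 => [set t | s <= t <= s]
  | 1 => neighborhood1 s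
  | m.+1 => \bigcup_(t in neighborhood m s) neighborhood1 t
  end.

Definition neighborhood_omega s : set L := \bigcup_n neighborhood n s.

Definition independent s1 s2 : Prop := ~ neighborhood_omega s2 s1.

End Proset.

Definition irreducible_proset {d : Order.disp_t} (L : preorderType d) : Prop :=
  ~ exists A B : set L,
      [/\ A `|` B = setT, A `&` B = set0, A !=set0 & B !=set0] /\
      forall a b, A a -> B b -> independent a b /\ independent b a.

Definition finite_neighborhoods {d : Order.disp_t} (L : preorderType d) : Prop :=
  forall s : L, finite_set (neighborhood1 s).

Definition locally_finite {d : Order.disp_t} (L : preorderType d) : Prop :=
  forall s t : L, finite_set [set u : L | (s <= u <= t)%O].

Lemma finite_neighborhoods_locally_finite {d : Order.disp_t}
    (L : preorderType d) : finite_neighborhoods L -> locally_finite L.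
Proof.
move=> fL s t; apply: sub_finite_set (fL s) => u /=.
by case/andP=> su _; rewrite /neighborhood1/= su orbT.
Qed.

Local Open Scope ring_scope.

(* The proof of local finiteness is a parameter of the type because the
   product is associative only when the intervals are finite. *)
Record incidence {d : Order.disp_t} {L : preorderType d} (P : nzRingType)
    (Lfin : locally_finite L) : Type := Incidence {
  coef :> L -> L -> P;
  coefP : `[< forall s t, coef s t != 0 -> (s <= t)%O >] }.

Section IncidenceRing.
Context {d : Order.disp_t} {L : preorderType d} (P : nzRingType)
  (Lfin : locally_finite L).
Local Notation M := (incidence P Lfin).
Implicit Types a b c : M.

HB.instance Definition _ := [isSub for @coef d L P Lfin].
HB.instance Definition _ := [Choice of M by <:].

Lemma incidenceP a b : (forall s t, a s t = b s t) -> a = b.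
Proof. by move=> ab; apply: val_inj; apply/funext => s; apply/funext => t; exact: ab. Qed.

Lemma coef_supp a {s t} : ~~ (s <= t)%O -> a s t = 0.
Proof. by apply: contraNeq; apply: (asboolW (coefP a)). Qed.

Program Definition inc_zero : M := @Incidence _ _ _ _ (fun _ _ => 0) _.
Next Obligation. by apply/asboolP => s t; rewrite eqxx. Qed.

Program Definition inc_opp a : M := @Incidence _ _ _ _ (fun s t => - a s t) _.
Next Obligation.
by move=> a; apply/asboolP => s t; apply: contraR => /coef_supp ->; rewrite oppr0.
Qed.

Program Definition inc_add a b : M :=
  @Incidence _ _ _ _ (fun s t => a s t + b s t) _.
Next Obligation.
move=> a b; apply/asboolP => s t; apply: contraR => st.
by rewrite !coef_supp// addr0.
Qed.

Program Definition inc_one : M :=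
  @Incidence _ _ _ _ (fun s t => (s == t)%:R) _.
Next Obligation.
by apply/asboolP => s t; case: (eqVneq s t) => [->|]; rewrite ?lexx ?eqxx.
Qed.

Program Definition inc_mul a b : M :=
  @Incidence _ _ _ _
    (fun s u => \sum_(t \in [set t | (s <= t <= u)%O]) a s t * b t u) _.
Next Obligation.
move=> a b; apply/asboolP => s u; apply: contraR => su.
rewrite fsbig1// => t /= /andP[st tu].
by rewrite (le_trans st tu) in su.
Qed.

Lemma inc_addA : associative inc_add.
Proof. by move=> a b c; apply: incidenceP => s t /=; rewrite addrA. Qed.

Lemma inc_addC : commutative inc_add.
Proof. by move=> a b; apply: incidenceP => s t /=; rewrite addrC. Qed.

Lemma inc_add0 : left_id inc_zero inc_add.
Proof. by move=> a; apply: incidenceP => s t /=; rewrite add0r. Qed.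

Lemma inc_addN : left_inverse inc_zero inc_opp inc_add.
Proof. by move=> a; apply: incidenceP => s t /=; rewrite addNr. Qed.

HB.instance Definition _ :=
  GRing.isZmodule.Build M inc_addA inc_addC inc_add0 inc_addN.

Lemma inc_mulE a b s u (D : set L) : finite_set D ->
    [set t | (s <= t <= u)%O] `<=` D ->
  inc_mul a b s u = \sum_(t <- fset_set D) a s t * b t u.
Proof.
move=> finD subD; rewrite -fsbig_finite//=.
apply: fsbig_widen => // t [_ /= /negP].
rewrite negb_and => /orP[st|tu]; first by rewrite (coef_supp a st) mul0r.
by rewrite (coef_supp b tu) mulr0.
Qed.

Lemma inc_mulA : associative inc_mul.
Proof.
move=> a b c; apply: incidenceP => s u.
pose D := [set t : L | (s <= t <= u)%O].
have finD : finite_set D := Lfin s u.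
rewrite !(inc_mulE _ _ finD)//.
have -> : \sum_(t <- fset_set D) a s t * inc_mul b c t u =
    \sum_(t <- fset_set D) \sum_(v <- fset_set D) a s t * b t v * c v u.
  apply: eq_big_seq => t; rewrite in_fset_set// inE => /andP[st tu].
  rewrite (inc_mulE _ _ finD) ?mulr_sumr; last first.
    by move=> v /= /andP[tv vu]; rewrite /D/= vu (le_trans st tv).
  by under eq_bigr do rewrite mulrA.
rewrite exchange_big.
apply: eq_big_seq => v; rewrite in_fset_set// inE => /andP[sv vu].
rewrite (inc_mulE _ _ finD) ?mulr_suml// => t /= /andP[st tv].
by rewrite /D/= st (le_trans tv vu).
Qed.

Lemma inc_mul1 : left_id inc_one inc_mul.
Proof.
move=> a; apply: incidenceP => s u /=.
have [su|su] := boolP (s <= u)%O; last first.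
  rewrite coef_supp// fsbig1// => t /= /andP[st tu].
  by rewrite (le_trans st tu) in su.
rewrite (fsbigD1 s)//=; last by rewrite lexx.
rewrite eqxx mul1r fsbig1 ?addr0// => t [_ /= ts].
by case: eqVneq ts => [->|_ _] //; rewrite mul0r.
Qed.

Lemma inc_mulr1 : right_id inc_one inc_mul.
Proof.
move=> a; apply: incidenceP => s u /=.
have [su|su] := boolP (s <= u)%O; last first.
  rewrite coef_supp// fsbig1// => t /= /andP[st tu].
  by rewrite (le_trans st tu) in su.
rewrite (fsbigD1 u)//=; last by rewrite lexx su.
rewrite eqxx mulr1 fsbig1 ?addr0// => t [_ /= tu].
by case: eqVneq tu => [->|_ _] //; rewrite mulr0.
Qed.

Lemma inc_mulDl : left_distributive inc_mul inc_add.
Proof.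
move=> a b c; apply: incidenceP => s u /=.
rewrite !fsbig_finite// -big_split/=.
by apply: eq_bigr => t _; rewrite mulrDl.
Qed.

Lemma inc_mulDr : right_distributive inc_mul inc_add.
Proof.
move=> a b c; apply: incidenceP => s u /=.
rewrite !fsbig_finite// -big_split/=.
by apply: eq_bigr => t _; rewrite mulrDr.
Qed.

HB.instance Definition _ := GRing.Zmodule_isPzRing.Build M
  inc_mulA inc_mul1 inc_mulr1 inc_mulDl inc_mulDr.

(* The topology induced by the product topology on P^(L x L), P being
   discrete. *)
Definition inc_entries (a : M) : {ptws L * L -> discrete_topology P} :=
  fun st => a st.1 st.2.

HB.instance Definition _ := Topological.copy M (initial_topology inc_entries).

End IncidenceRing.

Definition units (R : pzRingType) : set R :=
  [set x | exists y, x * y = 1 /\ y * x = 1].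
Arguments units : clear implicits.

Definition unit_group (R : pzRingType) : Type := set_type (units R).

Section UnitGroup.
Context (R : pzRingType).
Local Notation G := (unit_group R).

HB.instance Definition _ := Choice.copy G (set_type (units R)).

Definition unit_val (x : G) : R := set_val x.

Lemma unit_val_inj : injective unit_val.
Proof. exact: val_inj. Qed.

Lemma unit_valP (x : G) : exists y, unit_val x * y = 1 /\ y * unit_val x = 1.
Proof. exact: (set_mem (valP x)). Qed.

Definition unit_val_inv (x : G) : R := projT1 (cid (unit_valP x)).

Lemma unit_val_mulV x : unit_val x * unit_val_inv x = 1.
Proof. by rewrite /unit_val_inv; case: cid => y []. Qed.

Lemma unit_val_Vmul x : unit_val_inv x * unit_val x = 1.
Proof. by rewrite /unit_val_inv; case: cid => y []. Qed.

Lemma units1 : (1 : R) \in units R.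
Proof. by apply/mem_set; exists 1; rewrite mulr1. Qed.

Lemma unitsM (x y : G) : unit_val x * unit_val y \in units R.
Proof.
apply/mem_set; exists (unit_val_inv y * unit_val_inv x); split.
  by rewrite mulrA -(mulrA (unit_val x)) unit_val_mulV mulr1 unit_val_mulV.
by rewrite mulrA -(mulrA (unit_val_inv y)) unit_val_Vmul mulr1 unit_val_Vmul.
Qed.

Lemma unitsV (x : G) : unit_val_inv x \in units R.
Proof.
apply/mem_set; exists (unit_val x).
by rewrite unit_val_mulV unit_val_Vmul.
Qed.

Definition unit_one : G := @exist _ (fun z : R => z \in units R) 1 units1.
Definition unit_mul (x y : G) : G := @exist _ (fun z : R => z \in units R) _ (unitsM x y).
Definition unit_inv (x : G) : G := @exist _ (fun z : R => z \in units R) _ (unitsV x).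

Lemma unit_mulA : associative unit_mul.
Proof. by move=> x y z; apply: unit_val_inj; exact: mulrA. Qed.

Lemma unit_mul1 : left_id unit_one unit_mul.
Proof. by move=> x; apply: unit_val_inj; exact: mul1r. Qed.

Lemma unit_mulr1 : right_id unit_one unit_mul.
Proof. by move=> x; apply: unit_val_inj; exact: mulr1. Qed.

Lemma unit_mulV : left_inverse unit_one unit_inv unit_mul.
Proof. by move=> x; apply: unit_val_inj; exact: unit_val_Vmul. Qed.

Lemma unit_mulrV : right_inverse unit_one unit_inv unit_mul.
Proof. by move=> x; apply: unit_val_inj; exact: unit_val_mulV. Qed.

HB.instance Definition _ := isGroup.Build G
  unit_mulA unit_mul1 unit_mulr1 unit_mulV unit_mulrV.

End UnitGroup.

HB.structure Definition PreTopologicalGroup := {G of Group G & Topological G}.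

HB.mixin Record PreTopologicalGroup_isTopologicalGroup G
    & PreTopologicalGroup G := {
  mulg_continuous : continuous (fun x : G * G => (x.1 * x.2)%g);
  invg_continuous : continuous (fun x : G => (x^-1)%g) }.

#[short(type="topologicalGroupType")]
HB.structure Definition TopologicalGroup :=
  {G of PreTopologicalGroup G & PreTopologicalGroup_isTopologicalGroup G}.

Definition centralizer (G : groupType) (g : G) : set G := [set x | commute g x].

Definition quasicentre (G : topologicalGroupType) : set G :=
  [set g | open (centralizer g)].
Arguments quasicentre : clear implicits.

Definition GL {d : Order.disp_t} {L : preorderType d} (P : nzRingType)
  (Lfin : locally_finite L) : Type := unit_group (incidence P Lfin).

Section GeneralLinear.
Context {d : Order.disp_t} {L : preorderType d} (P : nzRingType)
  (Lfin : locally_finite L).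
Local Notation M := (incidence P Lfin).
Local Notation G := (GL P Lfin).

HB.instance Definition _ := Group.copy G (unit_group M).
(* set_type carries the subspace topology. *)
HB.instance Definition _ := Topological.copy G (set_type (units M)).

Definition GL_val (x : G) : M := @unit_val M x.

Lemma GL_coefM (x y : G) s u : GL_val (x * y)%g s u =
  \sum_(t \in [set t | (s <= t <= u)%O]) GL_val x s t * GL_val y t u.
Proof. by []. Qed.

Lemma nbhs_GL_coef (g : G) s t :
  \forall x \near g, GL_val x s t = GL_val g s t.
Proof.
pose f (x : G) : discrete_topology P := GL_val x s t.
have cf : continuous f.
  move=> x.
  apply: (@continuous_comp _ _ _ (@inc_entries _ _ P Lfin \o set_val : G -> _)
    (fun h : {ptws L * L -> discrete_topology P} => h (s, t))).
    apply: continuous_comp; exact: initial_continuous.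
  exact: (@proj_continuous _ (fun=> discrete_topology P)).
exact: (cf g _ (discrete_set1 (f g))).
Qed.

Lemma continuous_GL (T : topologicalType) (f : T -> G) :
    (forall x s t, \forall y \near x, GL_val (f y) s t = GL_val (f x) s t) ->
  continuous f.
Proof.
move=> cf; apply: continuous_comp_initial; apply: continuous_comp_initial.
move=> x; apply/cvg_sup => -[s t].
move=> U [_ [[V _ <-] /= Vx sVU]].
apply: filterS sVU _; apply: filterS (cf x s t) => y /= yx.
by rewrite /inc_entries/= -/(GL_val _) yx.
Qed.

Lemma nbhs_GL_interval (g : G) s t : \forall x \near g, forall u v,
  (s <= u <= t)%O -> (s <= v <= t)%O -> GL_val x u v = GL_val g u v.
Proof.
have fD := finite_setX (Lfin s t) (Lfin s t).
have := @filter_bigI G _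
  (fset_set ([set u | (s <= u <= t)%O] `*` [set u | (s <= u <= t)%O]))
  (fun uv => [set x : G | GL_val x uv.1 uv.2 = GL_val g uv.1 uv.2])
  (nbhs g) (nbhs_filter g) (fun uv _ => nbhs_GL_coef g uv.1 uv.2).
move/filterS; apply => x xg u v su sv; apply: (xg (u, v)).
by rewrite /= in_fset_set// inE.
Qed.

Lemma GL_mul_continuous : continuous (fun x : G * G => (x.1 * x.2)%g).
Proof.
apply: continuous_GL => -[g h] s u.
exists ([set x | forall v w, (s <= v <= u)%O -> (s <= w <= u)%O ->
           GL_val x v w = GL_val g v w],
        [set x | forall v w, (s <= v <= u)%O -> (s <= w <= u)%O ->
           GL_val x v w = GL_val h v w]).
  by split; exact: nbhs_GL_interval.
move=> [x y] [/= xg yh].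
rewrite -[LHS]/(GL_val (x * y)%g s u) -[RHS]/(GL_val (g * h)%g s u) !GL_coefM.
apply: eq_fsbigr => t; rewrite inE => /= stu.
have /andP[st tu] := stu; have su := le_trans st tu.
by rewrite xg ?yh ?lexx ?st ?su.
Qed.

Lemma GL_inv_continuous : continuous (fun x : G => (x^-1)%g).
Proof.
apply: continuous_GL => g s t.
apply: filterS (nbhs_GL_interval g s t) => x xg.
have -> : GL_val x^-1%g = GL_val g^-1%g +
    GL_val x^-1%g * (GL_val g - GL_val x) * GL_val g^-1%g.
  rewrite mulrBr mulrBl -mulrA (unit_val_mulV (g : unit_group M)).
  rewrite (unit_val_Vmul (x : unit_group M)).
  by rewrite mulr1 mul1r addrC subrK.
rewrite -[RHS]addr0; congr (_ + _).
rewrite /= fsbig1// => v /andP[sv vt].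
rewrite fsbig1 ?mul0r// => u /andP[su uv].
by rewrite /= xg ?subrr ?mulr0// ?su ?sv ?vt ?(le_trans uv vt).
Qed.

HB.instance Definition _ := PreTopologicalGroup_isTopologicalGroup.Build G
  GL_mul_continuous GL_inv_continuous.

End GeneralLinear.

(* Main.v *)
(* Replacing all entries of a matrix outside a finite convex D x D by those of
   the identity is multiplicative, hence turns invertible matrices into
   invertible ones; letting D grow, every g is a limit of its truncations. A
   truncation differs from 1 only in entries with both indices in D, and when
   it is multiplied by x such entries only meet entries of x whose indices lie
   in the finite set of all neighbours of D. So its centralizer is cut out by
   conditions on finitely many entries, and is therefore open. *)
Require Import Defs.
From mathcomp Require Import all_boot all_order all_algebra finmap.
From mathcomp Require Import boolp classical_sets functions cardinality fsbigop.
From mathcomp Require Import filter topology.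

Set Implicit Arguments.
Unset Strict Implicit.
Unset Printing Implicit Defensive.

Import Order.TTheory GRing.Theory.
Local Open Scope classical_set_scope.
Local Open Scope ring_scope.

Definition order_convex {d : Order.disp_t} {L : preorderType d} (D : set L) :=
  forall s t u, D s -> D u -> (s <= t <= u)%O -> D t.

(** The union of all intervals with both endpoints in [F] works: it is finite by local finiteness
    and convex by transitivity. *)
Lemma finite_sub_convex {d : Order.disp_t} {L : preorderType d} (F : set L) :
    locally_finite L -> finite_set F ->
  exists D : set L, [/\ finite_set D, order_convex D & F `<=` D].
Proof.
move=> Lfin finF.
exists (\bigcup_(s in F) \bigcup_(u in F) [set t | (s <= t <= u)%O]); split.
- by apply: bigcup_finite => // s _; apply: bigcup_finite.
- move=> s t u [a Fa [? _ /andP[la _]]] [? _ [b Fb /andP[_ lb]]] /andP[st tu].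
  by exists a => //; exists b => //=; rewrite (le_trans la st) (le_trans tu lb).
- by move=> s Fs; exists s => //; exists s => //=; rewrite lexx.
Qed.

Section Truncation.
Context {d : Order.disp_t} {L : preorderType d} (P : nzRingType)
  (Lfin : locally_finite L).
Local Notation M := (incidence P Lfin).
Local Notation G := (GL P Lfin).
Implicit Types (D : set L) (a b : M).

Program Definition truncation D a : M := @Incidence _ _ _ _
  (fun s t => if `[< D s /\ D t >] then a s t else (1 : M) s t) _.
Next Obligation.
move=> D a; apply/asboolP => s t.
by case: ifP => _; apply: contraR => st; rewrite coef_supp.
Qed.

Lemma truncation_in D a s t : D s -> D t -> truncation D a s t = a s t.
Proof. by move=> Ds Dt /=; rewrite asboolT. Qed.

Lemma truncation_out D a s t : ~ (D s /\ D t) -> truncation D a s t = (1 : M) s t.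
Proof. by move=> ND /=; rewrite asboolF. Qed.

Lemma truncation1 D : truncation D 1 = 1.
Proof. by apply: incidenceP => s t /=; case: ifP. Qed.

Lemma truncationM D a b : order_convex D ->
  truncation D (a * b) = truncation D a * truncation D b.
Proof.
move=> convD; apply: incidenceP => s u.
have [Ds|NDs] := pselect (D s); last first.
  rewrite truncation_out => [|[]//].
  (* Row [s] of either truncation is that of the identity, so the left factor may be exchanged for
     [1]; the case of column [u] below is dual. *)
  transitivity ((1 * truncation D b) s u).
    by rewrite mul1r truncation_out// => -[].
  by apply: eq_fsbigr => t _; rewrite [in RHS]truncation_out// => -[].
have [Du|NDu] := pselect (D u); last first.
  rewrite truncation_out => [|[]//].
  transitivity ((truncation D a * 1) s u).
    by rewrite mulr1 truncation_out// => -[].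
  by apply: eq_fsbigr => t _; rewrite [in RHS](@truncation_out _ b)// => -[].
rewrite truncation_in//; apply: eq_fsbigr => t; rewrite inE => stu.
(* Convexity puts every summation index between [s] and [u] into [D], so no term of the sum is
   altered. *)
by have Dt := convD _ _ _ Ds Du stu; rewrite !truncation_in.
Qed.

Lemma truncation_units D (g : G) : order_convex D ->
  truncation D (GL_val g) \in units M.
Proof.
move=> convD; apply/mem_set; exists (truncation D (GL_val g^-1%g)).
rewrite -!truncationM// (unit_val_mulV (g : unit_group M)).
by rewrite (unit_val_Vmul (g : unit_group M)) truncation1.
Qed.

Definition GL_truncation D (convD : order_convex D) (g : G) : G :=
  @exist _ (fun z : M => z \in units M) _ (truncation_units g convD).

Definition agree_on D (g h : G) :=
  forall s t, D s -> D t -> GL_val h s t = GL_val g s t.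

Lemma nbhs_agree_on D (g : G) : finite_set D -> \forall h \near g, agree_on D g h.
Proof.
move=> finD; have finDD := finite_setX finD finD.
have := @filter_bigI G _ (fset_set (D `*` D))
  (fun st => [set h : G | GL_val h st.1 st.2 = GL_val g st.1 st.2])
  (nbhs g) (nbhs_filter g) (fun st _ => nbhs_GL_coef g st.1 st.2).
move/filterS; apply => h hg s t Ds Dt; apply: (hg (s, t)).
by rewrite /= in_fset_set// inE.
Qed.

(** The sets [agree_on F g] with [F] finite generate a filter along which each entry is eventually
    equal to that of [g]; hence it converges to [g], which is the claim. *)
Lemma nbhs_GLP (g : G) (U : set G) : nbhs g U ->
  exists2 F, finite_set F & agree_on F g `<=` U.
Proof.
pose B := filter_from (@finite_set L) (fun F => agree_on F g).
have FB : Filter B.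
  apply: filter_from_filter; first by exists set0; exact: finite_set0.
  move=> A C finA finC; exists (A `|` C); first by rewrite finite_setU.
  by move=> h hg; split=> s t ? ?; apply: hg; [left|left|right|right].
have : B --> g; last by move=> Bg /Bg [F]; exists F.
have entB s t : B [set h : G | GL_val h s t = GL_val g s t].
  exists [set s; t]; first exact: finite_set2.
  by move=> h hg /=; apply: hg; [left|right].
have cvg_ent : (@inc_entries _ _ P Lfin \o set_val : G -> _) @ B -->
    (inc_entries (GL_val g) : {ptws L * L -> discrete_topology P}).
  apply/cvg_sup => -[s t] V [_ [[W _ <-] /= Wg sWV]].
  apply: filterS sWV _; apply: filterS (entB s t) => h /= hg.
  by rewrite /inc_entries/= -/(GL_val _) hg.
(* The topologies of the group and of the matrix ring are both initial, so [V] contains the preimage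
   of an open [W] of the product space. *)
move=> V [_ [[_ [W oW <-] <-] /= Wg sWV]].
apply: filterS sWV _; apply: cvg_ent; exact: open_nbhs_nbhs.
Qed.

Lemma GL_truncation_quasicentre D (convD : order_convex D) (g : G) :
  finite_neighborhoods L -> finite_set D ->
  quasicentre G (GL_truncation convD g).
Proof.
move=> Lfn finD; rewrite /quasicentre/=; set h := GL_truncation convD g.
pose T := \bigcup_(s in D) neighborhood1 s.
have finT : finite_set T by apply: bigcup_finite.
have TN s t : D s -> (s <= t)%O || (t <= s)%O -> T s /\ T t.
  by move=> Ds st; split; exists s; rewrite // /neighborhood1/= ?lexx// orbC.
(* Subtracting the central element [1] does not affect commutation and leaves a matrix supported on
   [D * D]. *)
have commE (x : G) : centralizer h x <->
    (GL_val h - 1) * GL_val x = GL_val x * (GL_val h - 1).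
  rewrite mulrBl mulrBr mul1r mulr1; split=> [hx|/addIr hx]; last first.
    exact: unit_val_inj.
  by congr (_ - _); exact: (congr1 (@GL_val _ _ _ _) hx).
have h1 s t : ~ (D s /\ D t) -> (GL_val h - 1) s t = 0.
  move=> ND; rewrite -[LHS]/(truncation D (GL_val g) s t - (1 : M) s t).
  by rewrite truncation_out// subrr.
rewrite openE => y /commE yh; rewrite /interior.
apply: filterS (nbhs_agree_on y finT) => x xy; apply/commE.
(* In a nonzero term [t] lies in [D] and [u] is comparable to [t], so the entry of [x] at [t], [u]
   has both indices in [T], where [x] and [y] agree. *)
have -> : (GL_val h - 1) * GL_val x = (GL_val h - 1) * GL_val y.
  apply: incidenceP => s u; apply: eq_fsbigr => t; rewrite inE => /andP[st tu].
  have [[Ds Dt]|/h1->] := pselect (D s /\ D t); last by rewrite !mul0r.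
  by have [Tt Tu] := TN t u Dt (introT orP (or_introl tu)); rewrite xy.
rewrite yh; apply: incidenceP => s u; apply: eq_fsbigr => t.
rewrite inE => /andP[st tu].
have [[Dt Du]|/h1->] := pselect (D t /\ D u); last by rewrite !mulr0.
by have [Tt Ts] := TN t s Dt (introT orP (or_intror st)); rewrite xy.
Qed.

End Truncation.

Theorem lemma3p21 (d : Order.disp_t) (L : preorderType d)
    (P : finComNzRingType)
    (Linf : infinite_set [set: L])
    (Lirr : irreducible_proset L)
    (Lfn : finite_neighborhoods L) :
  dense (quasicentre (GL P (finite_neighborhoods_locally_finite Lfn))).
Proof.
move=> O [g Og] oO.
have [F finF FO] : exists2 F, finite_set F & agree_on F g `<=` O.
  by apply: nbhs_GLP; exact: open_nbhs_nbhs.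
have [D [finD convD FD]] :=
  finite_sub_convex (finite_neighborhoods_locally_finite Lfn) finF.
exists (GL_truncation convD g); split; last exact: GL_truncation_quasicentre.
(* The truncation keeps the entries of [g] on [D], which contains [F], and so stays in [O]. *)
by apply: FO => s t /FD Ds /FD Dt; exact: truncation_in.
Qed.
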